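(* Let $p\in\mathbb{N}$ and let $\gamma^*$ be a DAG on $[p]$. Suppose the random vector $X=(X_1,\dots,X_p)^{\mathrm T}$ is generated by the linear structural equation model \[X_j = X_{\mathrm{pa}^*(j)}^{\mathrm T}\beta_j^* + \epsilon_j,\qquad j\in[p],\] where $\mathrm{pa}^*(j)$ is the parent set of $j$ in $\gamma^*$, every entry of $\beta_j^*\in\mathbb{R}^{|\mathrm{pa}^*(j)|}$ is non-zero, and $\epsilon_1,\dots,\epsilon_p$ are independent with $E(\epsilon_j)=0$ and $\mathrm{var}(\epsilon_j)=\sigma^2$ for all $j$, for a common $\sigma^2>0$. For every DAG $\gamma$ on $[p]$ define \[ r_j^\gamma := \min_{\beta_j\in\mathbb{R}^{|\mathrm{pa}^\gamma(j)|}} E\big(X_j - X_{\mathrm{pa}^\gamma(j)}^{\mathrm T}\beta_j\big)^2,\quad j\in[p],\qquad r^\gamma:=\sum_{j=1}^p r_j^\gamma ,\] (with $r_j^\gamma = E(X_j^2)$ when $\mathrm{pa}^\gamma(j)=\emptyset$), and write $r^* := r^{\gamma^*}$. Then for every DAG $\gamma$ on $[p]$, $r^\gamma\ge r^*$ $(=p\sigma^2)$, and equality holds if and only if $\gamma\supseteq\gamma^*$, i.e. every directed edge of $\gamma^*$ is an edge of $\gamma$.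
   Context: A DAG on $[p]=\{1,\dots,p\}$ is a pair $([p],E)$ with $E\subset[p]\times[p]$ a set of directed edges containing no directed cycle; $(k,j)\in E$ means $k$ is a parent of $j$, and $\mathrm{pa}^\gamma(j)$ denotes the set of parents of $j$ in $\gamma$. For $x\in\mathbb{R}^p$ and $I\subset[p]$, $x_I$ is the subvector $(x_k)_{k\in I}$. $\gamma'\supseteq\gamma$ means the edge set of $\gamma'$ contains that of $\gamma$. Expectations are under the true data-generating distribution of the model. *)

(* Defs.v *)
From HB Require Import structures.
From mathcomp Require Import all_boot all_order all_algebra.
From mathcomp Require Import all_classical all_reals all_analysis.
Set Implicit Arguments. Unset Strict Implicit. Unset Printing Implicit Defensive.
Import Order.TTheory GRing.Theory Num.Theory.
Local Open Scope classical_set_scope.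
Local Open Scope ring_scope.

(* A directed graph on [p] = 'I_p is a set of directed edges; (k, j) \in E
   means k is a parent of j. *)
Definition edge_rel (p : nat) (E : {set 'I_p * 'I_p}) : rel 'I_p :=
  fun k j => (k, j) \in E.

Definition is_dag (p : nat) (E : {set 'I_p * 'I_p}) : Prop :=
  forall k j : 'I_p, (k, j) \in E -> ~~ connect (edge_rel E) j k.

(* Mutual independence of a finite family of real random variables:
   product rule for every choice of measurable sets (taking B i = setT
   recovers every subfamily). *)
Definition mutually_independent d (T : measurableType d) (R : realType)
  (P : probability T R) (n : nat) (f : 'I_n -> T -> R) : Prop :=
  forall B : 'I_n -> set R, (forall i, measurable (B i)) ->
    P (\bigcap_(i in [set: 'I_n]) (f i @^-1` B i)) =
    (\prod_(i < n) P (f i @^-1` B i))%E.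

(* Population residual r_j^gamma : infimum (= minimum) over regression
   coefficients on the parents of j in gamma of E (X_j - X_pa^T beta)^2.
   beta is given as a function on [p]; only its values on pa^gamma(j) matter. *)
Definition resid_risk d (T : measurableType d) (R : realType)
  (P : probability T R) (p : nat) (X : 'I_p -> T -> R)
  (E : {set 'I_p * 'I_p}) (j : 'I_p) : \bar R :=
  ereal_inf [set ('E_P[ (fun t => (X j t -
                     \sum_(k < p | (k, j) \in E) beta k * X k t) ^+ 2)%R ])%E
            | beta in [set: 'I_p -> R]].

Definition total_risk d (T : measurableType d) (R : realType)
  (P : probability T R) (p : nat) (X : 'I_p -> T -> R)
  (E : {set 'I_p * 'I_p}) : \bar R :=
  (\sum_(j < p) resid_risk P X E j)%E.

(* Main.v *)
Require Import Defs.
From HB Require Import structures.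
From mathcomp Require Import all_boot all_order all_fingroup all_algebra.
From mathcomp Require Import all_classical all_reals all_analysis.
From mathcomp Require Import measurable_realfun ring lra.
Set Implicit Arguments. Unset Strict Implicit. Unset Printing Implicit Defensive.
Import Order.TTheory GRing.Theory Num.Theory.
Local Open Scope classical_set_scope.
Local Open Scope ring_scope.

(* With K = I - B*, the model reads K X = eps, and the residuals of the best
   regressions along a DAG gamma form the vector L X = M eps, where L = I - B is
   supported on gamma and M = L K^-1. Since the noises are uncorrelated with
   variance sigma^2, the total risk is sigma^2 tr (M M^T). Acyclicity gives
   det L = det K = 1, so det (M M^T) = 1, and tr G >= p + ln (det G) for positive
   definite G yields the lower bound p sigma^2. In the equality case M M^T = I,
   so M^T L = K, and comparing diagonals along gamma, children first, gives
   M = I: hence L = K and the edges of gamma* are edges of gamma. *)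

(** * Gram matrices and the normal equations *)

Lemma gram_ge0 (R : realDomainType) (m n : nat) (N : 'M[R]_(m, n)) i :
  0 <= (N *m N^T) i i.
Proof.
by rewrite mxE sumr_ge0// => j _; rewrite mxE -expr2 sqr_ge0.
Qed.

Lemma gram_diag_eq0 (R : realDomainType) (m n : nat) (N : 'M[R]_(m, n)) i :
  (N *m N^T) i i = 0 -> row i N = 0.
Proof.
rewrite mxE => /psumr_eq0P h; apply/rowP => j; rewrite !mxE; apply/eqP.
rewrite -sqrf_eq0 expr2; have := h _ j isT; rewrite mxE => -> //.
by move=> k _; rewrite mxE -expr2 sqr_ge0.
Qed.

Lemma gram_eq0 (R : realDomainType) (m n : nat) (N : 'M[R]_(m, n)) :
  N *m N^T = 0 -> N = 0.
Proof.
move=> h; apply/row_matrixP => i; rewrite row0.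
by apply: gram_diag_eq0; rewrite h mxE.
Qed.

(** The normal equations stay solvable when [N] has dependent rows: [N *m N^T] and [N^T] have the
    same kernel, because a vanishing Gram matrix forces its factor to vanish. *)
Lemma least_squares (R : realFieldType) (m n : nat) (N : 'M[R]_(m, n))
    (y : 'rV[R]_n) :
  exists w : 'rV[R]_m, (y - w *m N) *m N^T = 0.
Proof.
set Z := cokermx (N *m N^T).
have NNZ : N *m N^T *m Z = 0 by apply/eqP; rewrite -submxE.
have NZ : N^T *m Z = 0.
  apply: trmx_inj; rewrite trmx0; apply: gram_eq0.
  by rewrite trmxK trmx_mul trmxK -mulmxA [N *m _]mulmxA NNZ mulmx0.
have /submxP[w hw] : (y *m N^T <= N *m N^T)%MS.
  by rewrite submxE -mulmxA NZ mulmx0.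
exists w.
by rewrite mulmxBl hw mulmxA subrr.
Qed.

(** * Trace against log-determinant for positive definite matrices *)

Definition posdef (R : numDomainType) (n : nat) (G : 'M[R]_n) :=
  G^T = G /\ forall v : 'rV_n, v != 0 -> 0 < (v *m G *m v^T) 0 0.

Lemma posdef_gram (R : realFieldType) (n : nat) (M : 'M[R]_n) :
  M \in unitmx -> posdef (M *m M^T).
Proof.
move=> uM; split; first by rewrite trmx_mul trmxK.
move=> v v0; rewrite mulmxA -mulmxA -trmx_mul lt0r gram_ge0 andbT.
apply: contra v0 => /eqP/gram_diag_eq0 h.
have {}h : v *m M = 0 by apply/row_matrixP => i; rewrite !ord1 h row0.
by rewrite -[v](mulmxK uM) h mul0mx.
Qed.

(* Induction on the size via the Schur complement of the top-left entry a,
   using a >= 1 + ln a. *)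
Lemma mxtrace_ge_lndet (R : realType) (n : nat) (G : 'M[R]_n) :
  posdef G ->
  [/\ 0 < \det G, n%:R + ln (\det G) <= \tr G
    & \tr G = n%:R + ln (\det G) -> G = 1%:M].
Proof.
elim: n G => [|n IH] G.
  rewrite det_mx00 ln1 addr0 /mxtrace big_ord0 => _.
  by split=> // _; rewrite [LHS]flatmx0 [RHS]flatmx0.
rewrite -[n.+1]/(1 + n)%N in G *.
move=> [symG posG].
pose a := G 0 0; pose b := dlsubmx G; pose C := drsubmx G.
pose S := C - a^-1 *: (b *m b^T).
have ula : ulsubmx G = a%:M.
  rewrite [LHS]mx11_scalar; congr (_ %:M); rewrite !mxE.
  by congr (G _ _); exact: val_inj.
have urb : ursubmx G = b^T by rewrite -[in LHS]symG -trmx_dlsub.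
have GE : G = block_mx a%:M b^T b C by rewrite -[LHS]submxK ula urb.
have a0 : 0 < a.
  have /posG : delta_mx 0 0 != 0 :> 'rV[R]_(1 + n).
    by apply/eqP => /matrixP/(_ 0 0)/eqP; rewrite !mxE !eqxx oner_eq0.
  by rewrite -rowE trmx_delta -colE !mxE.
have aV : a * a^-1 = 1 by rewrite mulfV// gt_eqF.
have detG : \det G = a * \det S.
  have -> : G = block_mx a%:M 0 b S *m block_mx 1%:M (a^-1 *: b^T) 0 1%:M.
    rewrite GE mulmx_block !mulmx1 !mulmx0 !addr0.
    by rewrite mul_scalar_mx scalerA aV scale1r -scalemxAr /S addrC subrK.
  by rewrite det_mulmx det_lblock det_ublock !det1 !mulr1 det_scalar1.
have trG : \tr G = a + \tr S + a^-1 * (b^T *m b) 0 0.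
  rewrite GE mxtrace_block mxtrace_scalar mulr1n /S raddfB /= mxtraceZ.
  by rewrite mxtrace_mulC trace_mx11 addrA subrK.
have posS : posdef S.
  split.
    by rewrite /S linearB /= linearZ /= trmx_mul trmxK /C trmx_drsub symG.
  (* The first entry of [v] completes the square: it makes [v *m G] equal to the row with entries 0
     and [u *m S]. *)
  move=> u u0; pose v := row_mx (- a^-1 *: (u *m b)) u.
  have -> : u *m S *m u^T = v *m G *m v^T.
    rewrite GE mul_row_block tr_row_mx mul_row_col.
    rewrite mul_mx_scalar scalerA mulrN aV scaleN1r addNr mul0mx add0r.
    congr (_ *m _).
    by rewrite /S mulmxBr -scalemxAl -scalemxAr scaleNr mulmxA addrC.
  apply: posG; apply: contra u0 => /eqP; rewrite -[0]row_mx0 => /eq_row_mx[_ ->//].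
have [S0 trS eqS] := IH S posS.
have bb : 0 <= (b^T *m b) 0 0 by rewrite -[X in _ *m X]trmxK gram_ge0.
have ab : 0 <= a^-1 * (b^T *m b) 0 0 by rewrite mulr_ge0// invr_ge0 ltW.
have lna : 1 + ln a <= a by rewrite -[leRHS](lnK a0) expR_ge1Dx.
have lnG : (1 + n)%:R + ln (\det G) = (1 + ln a) + (n%:R + ln (\det S)).
  by rewrite detG lnM// natrD; ring.
rewrite lnG trG; split; first by rewrite detG mulr_gt0.
  by lra.
move=> eqG.
(* The gap in the trace bound is a sum of three nonnegative slacks: one for [a], one for [b], one
   for [S]. Equality makes each of them zero. *)
have lnaE : 1 + ln a = a by lra.
have a1 : a = 1.
  have [l0|/expR_gt1Dx] := eqVneq (ln a) 0; first by rewrite -lnaE l0 addr0.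
  by rewrite lnK// lnaE ltxx.
have b0 : b = 0.
  apply: trmx_inj; rewrite trmx0; apply: gram_eq0.
  rewrite trmxK [LHS]mx11_scalar.
  have : a^-1 * (b^T *m b) 0 0 = 0 by lra.
  by rewrite a1 invr1 mul1r => ->; rewrite raddf0.
have S1 : S = 1%:M by apply: eqS; lra.
have C1 : C = 1%:M by rewrite -S1 /S b0 mul0mx scaler0 subr0.
by rewrite GE a1 b0 C1 trmx0 -scalar_mx_block.
Qed.

(** * Determinants, induction and rigidity along a DAG *)

(* The matrices I - B, where B j k is the coefficient of the parent k in the
   equation of j. *)
Definition dag_mx (R : nzRingType) (p : nat) (E : {set 'I_p * 'I_p})
    (L : 'M[R]_p) :=
  (forall j, L j j = 1) /\
  (forall j k, j != k -> (k, j) \notin E -> L j k = 0).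

(* A non-identity permutation with a nonzero term in the Leibniz expansion
   would contain a directed cycle. *)
Lemma det_dag_mx (R : idomainType) (p : nat) (E : {set 'I_p * 'I_p})
    (L : 'M[R]_p) :
  is_dag E -> dag_mx E L -> \det L = 1.
Proof.
move=> dagE [L1 L0]; rewrite /determinant (bigD1 1%g)//= odd_perm1 expr0 mul1r.
rewrite big1 ?mul1r => [|i _]; last by rewrite perm1 L1.
rewrite big1 ?addr0// => s s1; apply/eqP; rewrite mulf_eq0 signr_eq0 /=.
apply: contraT => /prodf_neq0 nz.
have [i si] : exists i, s i != i.
  apply/existsP; apply: contraR s1; rewrite negb_exists => /forallP h.
  by apply/eqP/permP => i; rewrite perm1; apply/eqP; move: (h i); rewrite negbK.
have edge j : connect (edge_rel E) (s j) j.
  have := nz j isT; have [->|sj] := eqVneq (s j) j; first by rewrite connect0.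
  by move=> Lj; apply/connect1; apply: contraNT Lj => nE; rewrite L0// eq_sym.
have iE : (s i, i) \in E.
  by have := nz i isT; apply: contraNT => nE; rewrite L0// eq_sym.
rewrite -(negbTE (dagE _ _ iE)).
(* Each [s j] reaches [j], so every iterate of [s] at [i] reaches [s i]. At the order of [s] this is
   a path from [i] to [s i], closing a cycle with the edge [(s i, i)]. *)
have : forall n, connect (edge_rel E) ((s ^+ n.+1)%g i) (s i).
  elim=> [|n IH]; first by rewrite expg1 connect0.
  by apply: connect_trans IH; rewrite expgSr permM.
by move=> /(_ #[s]%g.-1); rewrite prednK ?order_gt0// expg_order perm1.
Qed.

(** Induction on the number of vertices reachable from [j]: a child reaches only what [j] reaches,
    and by acyclicity it does not reach [j]. *)
Lemma dag_ind (p : nat) (E : {set 'I_p * 'I_p}) (Q : 'I_p -> Prop) :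
  is_dag E -> (forall j, (forall i, (j, i) \in E -> Q i) -> Q j) ->
  forall j, Q j.
Proof.
move=> dagE step j.
have [n] := ubnP #|connect (edge_rel E) j|; elim: n j => // n IH j jn.
apply: step => i ji; apply: IH; rewrite ltnS in jn; apply: leq_trans jn.
apply/proper_card/properP; split.
  apply/fintype.subsetP => k; rewrite !unfold_in => ik.
  exact: connect_trans (connect1 ji) ik.
exists j; first exact: connect0.
exact: dagE ji.
Qed.

(* Row j of M is the j-th unit vector as soon as this holds for the children
   of j: the (j, j) entry of M^T L = K then reads M j j = 1, and the rows of M
   have norm one. *)
Lemma orthogonal_dag_factor_eq1 (R : realFieldType) (p : nat)
    (E : {set 'I_p * 'I_p}) (M L K : 'M[R]_p) :
  is_dag E -> dag_mx E L -> (forall j, K j j = 1) ->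
  M *m M^T = 1%:M -> L = M *m K -> M = 1%:M.
Proof.
move=> dagE [L1 L0] K1 MM LMK.
have MLK : M^T *m L = K by rewrite LMK mulmxA (mulmx1C MM) mul1mx.
suff rowM j : row j M = row j 1%:M by apply/row_matrixP.
move: j; apply: (dag_ind dagE) => j IH.
have Mjj : M j j = 1.
  have /matrixP/(_ j j) := MLK; rewrite K1 mxE (bigD1 j)//= L1 mulr1 mxE.
  rewrite big1 ?addr0// => i ij; rewrite mxE.
  have [jiE|/L0 -> //] := boolP ((j, i) \in E); last by rewrite mulr0.
  have /rowP/(_ j) := IH _ jiE; rewrite !mxE => ->.
  by rewrite (negPf ij) mul0r.
apply/rowP => k; rewrite !mxE.
have [<-//|jk] := eqVneq j k.
have /matrixP/(_ j j) := MM; rewrite !mxE eqxx (bigD1 j)//= mxE Mjj mulr1.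
move=> /(canRL (addKr 1)); rewrite addNr => /psumr_eq0P h.
apply/eqP; rewrite -sqrf_eq0 expr2; have := h _ k; rewrite mxE => ->//.
  by move=> i _; rewrite mxE -expr2 sqr_ge0.
by rewrite eq_sym.
Qed.

(** * Second moments of independent noises *)

Lemma mutually_independent_pair d (T : measurableType d) (R : realType)
    (P : probability T R) (n : nat) (f : 'I_n -> T -> R) (i j : 'I_n)
    (A B : set R) :
  mutually_independent P f -> i != j -> measurable A -> measurable B ->
  P ((f i @^-1` A) `&` (f j @^-1` B)) = (P (f i @^-1` A) * P (f j @^-1` B))%E.
Proof.
move=> indep ij mA mB.
(* The full set at every other index contributes a factor 1 to the product rule. *)
pose C k := if k == i then A else if k == j then B else setT.
have mC k : measurable (C k) by rewrite /C; case: ifP => // _; case: ifP.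
have := indep C mC; rewrite (bigD1 i)//= (bigD1 j) 1?eq_sym//=.
rewrite [X in (_ * (_ * X))%E]big1 ?mule1; last first.
  move=> k /andP[/negPf ki /negPf kj].
  by rewrite /C ki kj preimage_setT probability_setT.
rewrite {2 3}/C eqxx eq_sym (negPf ij) eqxx => <-; congr (P _).
apply/seteqP; split=> t /=.
  move=> [tA tB] k _; rewrite /C /=.
  by case: (eqVneq k i) => [->//|_]; case: (eqVneq k j) => [->//|].
move=> h; split.
  by have := h i I; rewrite /C /= eqxx.
by have := h j I; rewrite /C /= eq_sym (negPf ij) eqxx.
Qed.

(* The joint law of X i and X j is the product of their laws, so Fubini applies. *)
Lemma mutually_independent_expectationM d (T : measurableType d) (R : realType)
    (P : probability T R) (n : nat) (X : 'I_n -> {RV P >-> R}) (i j : 'I_n) :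
  mutually_independent P (fun k => X k : T -> R) -> i != j ->
  (X i : T -> R) \in Lfun P 2%:E -> (X j : T -> R) \in Lfun P 2%:E ->
  ('E_P[(X i : T -> R) \* X j] = 'E_P[X i] * 'E_P[X j])%E.
Proof.
move=> indep ij Xi2 Xj2.
have PT : P setT \is a fin_num by rewrite probability_setT.
have /Lfun1_integrable Xi1 := Lfun_subset12 PT Xi2.
have /Lfun1_integrable Xj1 := Lfun_subset12 PT Xj2.
have /Lfun1_integrable XX1 := Lfun2_mul_Lfun1 Xi2 Xj2.
pose RR := (R * R)%type : measurableType _.
pose phi t : RR := (X i t, X j t).
have mphi : measurable_fun setT phi by exact: measurable_fun_pair.
pose g (z : RR) : \bar R := (z.1 * z.2)%:E.
have mg : measurable_fun [set: RR] g.
  by apply/measurable_EFinP; exact: measurable_funM.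
pose Di := distribution P (X i); pose Dj := distribution P (X j).
have phi_prod : forall A, measurable A -> (Di \x Dj)%E A = pushforward P phi A.
  apply: product_measure_unique => A B mA mB.
  exact: mutually_independent_pair indep ij mA mB.
have ig : (Di \x Dj)%E.-integrable [set: RR] g.
  have /integrableP[_ ioo] := integrable_pushforward mphi mg XX1 measurableT.
  apply/integrableP; split=> //; apply: le_lt_trans ioo.
  rewrite (eq_measure_integral (pushforward P phi))// => A mA _.
  by rewrite /= -phi_prod.
rewrite unlock -[LHS](integral_pushforward mphi mg XX1 measurableT).
rewrite (eq_measure_integral (Di \x Dj)%E); last first.
  by move=> A mA _; exact/esym/phi_prod.
rewrite -integral12_prod_meas1//.
(* The inner Fubini integral is the mean of [X j]; naming it as a real number allows it to be pulled
   out of the outer integral. *)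
have [c Ec] : exists c, (\int[P]_t (X j t)%:E = c%:E)%E.
  exists (fine (\int[P]_t (X j t)%:E)).
  by rewrite fineK//; exact: integrable_fin_num.
rewrite Ec; transitivity (\int[Di]_x (x%:E * c%:E))%E.
  apply: eq_integral => x _.
  rewrite -Ec /fubini_F /g -(integral_distribution (f := EFin))//.
  rewrite -integralZl//; exact: integrable_pushforward.
have mc : measurable_fun setT (fun x : R => x%:E * c%:E)%E.
  by apply/measurable_EFinP; exact: measurable_funM.
rewrite integral_distribution//=; last exact: integrableZr.
by rewrite integralZr.
Qed.

(** For a centered variable the variance is the integral of the square, so finite variance is square
    integrability. This supplies the integrability that products of noises require. *)
Lemma Lfun2_centered d (T : measurableType d) (R : realType)
    (P : probability T R) (X : {RV P >-> R}) :
  ('E_P[X] = 0 -> 'V_P[X] \is a fin_num ->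
  (X : T -> R) \in Lfun P 2%:E /\ 'E_P[(X : T -> R) \* X] = 'V_P[X])%E.
Proof.
move=> EX0; rewrite /variance covariance.unlock EX0 /=.
have -> : ((X \- cst 0) * (X \- cst 0) = (X : T -> R) \* X)%R.
  by apply/funext => t; rewrite /GRing.mul /= !subr0.
move=> VX; split=> //.
rewrite inE; apply/andP; split; first by rewrite inE/=; exact: measurable_funPT.
rewrite inE /= /finite_norm Lnorm.unlock poweR_lty//.
move: VX; rewrite unlock ge0_fin_numE; last first.
  by apply: integral_ge0 => t _; rewrite lee_fin /= -expr2 sqr_ge0.
apply: le_lt_trans; rewrite le_eqVlt; apply/orP; left; apply/eqP.
apply: eq_integral => t _ /=.
by rewrite powR_mulrn// -normrX ger0_norm ?sqr_ge0// expr2.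
Qed.

(** Expanding the square gives a double sum in which only the diagonal terms have nonzero
    expectation. *)
Lemma expectation_sqr_lincomb d (T : measurableType d) (R : realType)
    (P : probability T R) (n : nat) (X : 'I_n -> T -> R) (s : R) (c : 'rV[R]_n) :
  (forall i, X i \in Lfun P 2%:E) ->
  (forall i j, 'E_P[X i \* X j] = (s *+ (i == j))%:E)%E ->
  ('E_P[fun t => ((\sum_i c 0 i * X i t) ^+ 2)%R] = (s * (c *m c^T) 0 0)%R%:E)%E.
Proof.
move=> X2 EXX.
pose F (u : 'I_n * 'I_n) : T -> R := (c 0 u.1 * c 0 u.2) \o* (X u.1 \* X u.2).
have XX1 u : (X u.1 \* X u.2) \in Lfun P 1 by exact: Lfun2_mul_Lfun1.
have -> : (fun t => (\sum_i c 0 i * X i t) ^+ 2) =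
    \sum_(Y <- [seq F u | u <- enum {: 'I_n * 'I_n}]) Y.
  apply/funext => t; rewrite big_map fct_sumE big_enum /=.
  rewrite expr2 big_distrl /= -(pair_bigA _ (fun i j => F (i, j) t)) /=.
  apply: eq_bigr => i _; rewrite big_distrr /=; apply: eq_bigr => j _.
  by rewrite /F /=; ring.
rewrite expectation_sum; last first.
  by move=> Y /mapP[u _ ->]; rewrite /F Lfun_scale.
rewrite big_map big_enum /=.
under eq_bigr => u _ do rewrite expectationZl// EXX -EFinM.
rewrite sumEFin; congr (_%:E).
rewrite -(pair_bigA _ (fun i j => c 0 i * c 0 j * (s *+ (i == j)))) /=.
rewrite mxE mulr_sumr; apply: eq_bigr => i _.
rewrite (bigD1 i)//= eqxx mulr1n big1 ?addr0 ?mxE; first by ring.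
by move=> j ji; rewrite eq_sym (negPf ji) mulr0n mulr0.
Qed.

(** * Residual risks as squared norms of rows *)

(* Coordinates in (X_1, ..., X_p) of the residual X_j - X_pa(j)^T w. *)
Definition resid_row (R : nzRingType) (p : nat) (E : {set 'I_p * 'I_p})
    (j : 'I_p) (w : 'rV[R]_p) : 'rV[R]_p :=
  delta_mx 0 j - w *m diag_mx (\row_k ((k, j) \in E)%:R).

Lemma resid_rowE (R : nzRingType) (p : nat) (E : {set 'I_p * 'I_p})
    (j k : 'I_p) (w : 'rV[R]_p) :
  resid_row E j w 0 k = (j == k)%:R - w 0 k * ((k, j) \in E)%:R.
Proof. by rewrite /resid_row mul_mx_diag !mxE eqxx eq_sym. Qed.

Lemma dag_mx_resid (R : nzRingType) (p : nat) (E : {set 'I_p * 'I_p})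
    (w : 'I_p -> 'rV[R]_p) :
  is_dag E -> dag_mx E (\matrix_j resid_row E j (w j)).
Proof.
move=> dagE; split=> [j|j k jk kjE]; rewrite mxE resid_rowE.
  (* Acyclicity excludes self-loops, so the regression leaves the diagonal entry 1 untouched. *)
  have [/dagE|_] := boolP ((j, j) \in E); first by rewrite connect0.
  by rewrite eqxx mulr0 subr0.
by rewrite (negPf jk) (negPf kjE) mulr0 subr0.
Qed.

Lemma resid_row_sum (R : comNzRingType) (p : nat) (E : {set 'I_p * 'I_p})
    (j : 'I_p) (b x : 'I_p -> R) :
  x j - \sum_(k < p | (k, j) \in E) b k * x k =
  \sum_k resid_row E j (\row_k b k) 0 k * x k.
Proof.
under [RHS]eq_bigr => k _ do rewrite resid_rowE mxE mulrBl.
rewrite sumrB; congr (_ - _).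
  rewrite (bigD1 j)//= eqxx mul1r big1 ?addr0// => k kj.
  by rewrite eq_sym (negPf kj) mul0r.
rewrite big_mkcond; apply: eq_bigr => k _.
by case: ifP; rewrite ?mulr1 ?mulr0 ?mul0r.
Qed.

(** The moment hypothesis turns the regression into a Euclidean projection of row [j] of [A] onto
    the span of the parent rows; the infimum is reached at that projection. *)
Lemma resid_risk_attained d (T : measurableType d) (R : realType)
    (P : probability T R) (p : nat) (X : 'I_p -> T -> R) (A : 'M[R]_p) (s : R)
    (E : {set 'I_p * 'I_p}) (j : 'I_p) :
  0 <= s ->
  (forall l : 'rV_p, 'E_P[fun t => ((\sum_k l 0 k * X k t) ^+ 2)%R] =
     (s * ((l *m A) *m (l *m A)^T) 0 0)%:E)%E ->
  exists w : 'rV_p, resid_risk P X E j =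
    (s * ((resid_row E j w *m A) *m (resid_row E j w *m A)^T) 0 0)%:E.
Proof.
move=> s0 EX.
(* Rows of [A] at non-parents are zeroed, so [w] may range over all row vectors. *)
pose N := diag_mx (\row_k ((k, j) \in E)%:R) *m A.
have [w orth] := least_squares N (row j A).
have rE v : resid_row E j v *m A = row j A - v *m N.
  by rewrite mulmxBl -rowE mulmxA.
exists w; apply/eqP; rewrite eq_le; apply/andP; split.
  apply: ereal_inf_lbound; exists (fun k => w 0 k) => //.
  under eq_fun => t do rewrite (resid_row_sum _ _ _ (X^~ t)).
  by rewrite EX (_ : \row_k w 0 k = w)//; apply/rowP => k; rewrite mxE.
apply: le_ereal_inf_tmp => _ [b _ <-].
under eq_fun => t do rewrite (resid_row_sum _ _ _ (X^~ t)).
rewrite EX lee_fin ler_wpM2l// !rE; set v := \row_k b k.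
(* Pythagoras: the optimal residual is orthogonal to the rows of [N], so any other choice of
   coefficients adds a squared norm. *)
have -> : row j A - v *m N = (row j A - w *m N) + (w - v) *m N.
  by rewrite mulmxBl addrA subrK.
move: orth; set r := row j A - w *m N => orth.
have orth' : N *m r^T = 0 by rewrite -[N]trmxK -trmx_mul orth trmx0.
have -> : (r + (w - v) *m N) *m (r + (w - v) *m N)^T =
    r *m r^T + ((w - v) *m N) *m ((w - v) *m N)^T.
  move: (w - v) => x.
  rewrite [(r + x *m N)^T]linearD /= mulmxDl !(mulmxDr _ r^T).
  rewrite trmx_mul mulmxA orth mul0mx addr0.
  by rewrite -(mulmxA x N r^T) orth' mulmx0 add0r.
by rewrite [leRHS]mxE lerDl gram_ge0.
Qed.

Lemma total_risk_dag d (T : measurableType d) (R : realType)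
    (P : probability T R) (p : nat) (X : 'I_p -> T -> R) (K : 'M[R]_p) (s : R)
    (E : {set 'I_p * 'I_p}) :
  is_dag E -> 0 <= s -> K \in unitmx ->
  (forall l : 'rV_p, 'E_P[fun t => ((\sum_k l 0 k * X k t) ^+ 2)%R] =
     (s * ((l *m invmx K) *m (l *m invmx K)^T) 0 0)%:E)%E ->
  exists L M : 'M[R]_p, [/\ dag_mx E L, L = M *m K &
    total_risk P X E = (s * \tr (M *m M^T))%:E].
Proof.
move=> dagE s0 uK EX.
have [w wE] := choice (fun j => resid_risk_attained E j s0 EX).
pose L := \matrix_j resid_row E j (w j).
exists L, (L *m invmx K); split; first exact: dag_mx_resid.
  by rewrite mulmxKV.
rewrite /total_risk; under eq_bigr => j _ do rewrite wE.
rewrite sumEFin -mulr_sumr; congr (s * _)%:E; apply: eq_bigr => j _.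
rewrite -[resid_row E j (w j)](rowK (fun j => resid_row E j (w j))) -/L.
by rewrite -row_mul !mxE; apply: eq_bigr => k _; rewrite !mxE.
Qed.

(** * Comparison of the total risks *)

Lemma dag_mxtrace_ge (R : realType) (p : nat) (E Estar : {set 'I_p * 'I_p})
    (L M K : 'M[R]_p) :
  is_dag E -> is_dag Estar -> dag_mx E L -> dag_mx Estar K -> L = M *m K ->
  p%:R <= \tr (M *m M^T) /\ (\tr (M *m M^T) = p%:R -> L = K).
Proof.
move=> dagE dagEs dL dK LMK.
have detM : \det M = 1.
  have := det_dag_mx dagE dL.
  by rewrite LMK det_mulmx (det_dag_mx dagEs dK) mulr1.
have uM : M \in unitmx by rewrite unitmxE detM unitr1.
have [_] := mxtrace_ge_lndet (posdef_gram uM).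
rewrite det_mulmx det_tr detM mulr1 ln1 addr0 => trM eqM; split=> // /eqM MM.
by rewrite LMK (orthogonal_dag_factor_eq1 dagE dL (proj1 dK) MM LMK) mul1mx.
Qed.

Unset Implicit Arguments.

Theorem theorem1 (d : measure_display) (T : measurableType d) (R : realType)
  (P : probability T R) (p : nat)
  (Estar : {set 'I_p * 'I_p}) (beta_star : 'I_p -> 'I_p -> R)
  (eps : 'I_p -> {RV P >-> R}) (sigma2 : R) (X : 'I_p -> T -> R) :
  is_dag Estar ->
  (forall k j, (k, j) \in Estar -> beta_star k j != 0) ->
  mutually_independent P (fun i => (eps i : T -> R)) ->
  0 < sigma2 ->
  (forall j, ('E_P[eps j] = 0)%E) ->
  (forall j, ('V_P[eps j] = sigma2%:E)%E) ->
  (forall j t, X j t =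
     \sum_(k < p | (k, j) \in Estar) beta_star k j * X k t + eps j t) ->
  total_risk P X Estar = (p%:R * sigma2)%:E /\
  forall E : {set 'I_p * 'I_p}, is_dag E ->
    (total_risk P X Estar <= total_risk P X E)%E /\
    (total_risk P X E = total_risk P X Estar <-> Estar \subset E).
Proof.
move=> dagEs beta_neq0 indep s0 Eeps Veps XE.
have eps2 i : (eps i : T -> R) \in Lfun P 2%:E /\
    ('E_P[(eps i : T -> R) \* eps i] = sigma2%:E)%E.
  have [] := Lfun2_centered (Eeps i); first by rewrite Veps.
  by rewrite Veps.
have epsM i j : ('E_P[(eps i : T -> R) \* eps j] = (sigma2 *+ (i == j))%:E)%E.
  have [<-|ij] := eqVneq i j; first by have [_ ->] := eps2 i.
  rewrite (mutually_independent_expectationM indep ij) ?Eeps ?mul0e//.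
    by have [] := eps2 i.
  by have [] := eps2 j.
pose bstar j : 'rV[R]_p := \row_k beta_star k j.
pose K : 'M[R]_p := \matrix_j resid_row Estar j (bstar j).
have dK : dag_mx Estar K by exact: dag_mx_resid.
have uK : K \in unitmx by rewrite unitmxE (det_dag_mx dagEs dK) unitr1.
have epsK t : \col_j eps j t = K *m \col_j X j t.
  apply/colP => j; rewrite !mxE.
  under eq_bigr => k _ do rewrite [K _ _]mxE [(\col_ _ _) _ _]mxE.
  apply: (addrI (\sum_(k < p | (k, j) \in Estar) beta_star k j * X k t)).
  rewrite -XE.
  by rewrite -(resid_row_sum _ _ _ (X^~ t)) addrC subrK.
have EX (l : 'rV_p) : ('E_P[fun t => ((\sum_k l 0 k * X k t) ^+ 2)%R] =
    (sigma2 * ((l *m invmx K) *m (l *m invmx K)^T) 0 0)%:E)%E.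
  rewrite -(expectation_sqr_lincomb _ (fun i => proj1 (eps2 i)) epsM).
  congr expectation; apply/funext => t; congr (_ ^+ 2).
  have -> : \sum_k l 0 k * X k t = (l *m \col_k X k t) 0 0.
    by rewrite mxE; apply: eq_bigr => k _; rewrite mxE.
  (* Solving the model for [X] gives the inverse of [K] applied to the noises, so [l] becomes
     [l *m invmx K] in noise coordinates. *)
  rewrite -[\col_k _](mulKmx uK) -epsK mulmxA [LHS]mxE.
  by apply: eq_bigr => k _; congr (_ * _); rewrite mxE.
have lower E : is_dag E -> ((p%:R * sigma2)%:E <= total_risk P X E)%E /\
    (total_risk P X E = (p%:R * sigma2)%:E -> Estar \subset E).
  move=> dagE; have [L [M [dL LMK ->]]] := total_risk_dag dagE (ltW s0) uK EX.
  have [trM eqM] := dag_mxtrace_ge dagE dagEs dL dK LMK.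
  split; first by rewrite lee_fin mulrC ler_pM2l.
  move=> [/eqP]; rewrite mulrC (inj_eq (mulIf (lt0r_neq0 s0))) => /eqP /eqM LK.
  (* A true edge missing from [E] would give a zero entry of [L], whereas the same entry of [K] is
     minus a nonzero true coefficient. *)
  apply/fintype.subsetP => -[k j] kjEs; apply: contraT => kjE.
  have jk : j != k.
    by apply: contraTneq kjEs => ->; apply/negP => /dagEs; rewrite connect0.
  have := proj2 dL _ _ jk kjE; rewrite LK mxE resid_rowE !mxE (negPf jk) kjEs.
  by rewrite mulr1 sub0r => /eqP; rewrite oppr_eq0 (negPf (beta_neq0 _ _ kjEs)).
have upper (E : {set _}) : Estar \subset E ->
    (total_risk P X E <= (p%:R * sigma2)%:E)%E.
  move=> sub; apply: (@le_trans _ _ (\sum_(j < p) sigma2%:E)%E); last first.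
    by rewrite sumEFin sumr_const card_ord mulr_natl.
  apply: lee_sum => j _; have [_ <-] := eps2 j.
  apply: ereal_inf_lbound.
  (* The true coefficients, extended by zero to the extra parents in [E], leave exactly the noise
     [eps j] as residual. *)
  exists (fun k => if (k, j) \in Estar then beta_star k j else 0) => //.
  congr expectation; apply/funext => t /=; rewrite -expr2; congr (_ ^+ 2).
  rewrite XE [X in _ - X](_ : _ =
    \sum_(k < p | (k, j) \in Estar) beta_star k j * X k t).
    by rewrite addrAC subrr add0r.
  rewrite [LHS]big_mkcond [RHS]big_mkcond /=; apply: eq_bigr => k _.
  case: ifPn => [kE|kE]; first by case: ifP => // _; rewrite mul0r.
  by rewrite ifN//; apply: contra kE; apply: (fintype.subsetP sub).
have star : total_risk P X Estar = (p%:R * sigma2)%:E.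
  by apply/eqP; rewrite eq_le upper//= (proj1 (lower _ dagEs)).
rewrite star; split=> // E dagE; have [le_E eq_E] := lower E dagE.
split=> //; split=> // sub; apply/eqP.
by rewrite eq_le le_E upper.
Qed.
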